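(* Let $\lambda$ be an infinite regular cardinal and assume ${\mid\!\bullet}(\lambda^+)$ holds. Then for every partition $\mathcal S$ of $E^{\lambda^+}_\lambda$ into stationary sets, $\clubsuit_{\mathrm{ad}^*}(\mathcal S,\lambda,\lambda^+)$ holds.
   Context: $E^{\lambda^+}_\lambda=\{\alpha<\lambda^+\mid\mathrm{cf}(\alpha)=\lambda\}$. ${\mid\!\bullet}(\lambda^+)$ asserts there is a sequence $\langle x_\beta\mid\beta<\lambda^+\rangle$ of elements of $[\lambda^+]^\lambda$ such that for every cofinal $X\subseteq\lambda^+$ there is $\beta$ with $x_\beta\subseteq X$. For a regular uncountable $\kappa$, a collection $\mathcal S$ of stationary subsets of $\kappa$ and a nonzero cardinal $\mu<\kappa$, $\clubsuit_{\mathrm{ad}^*}(\mathcal S,\mu,\kappa)$ asserts the existence of $\langle\mathcal A_\alpha\mid\alpha\in\bigcup\mathcal S\rangle$ such that: (i) for every limit ordinal $\alpha\in\bigcup\mathcal S$, $\mathcal A_\alpha$ is a pairwise disjoint family of $\mu$ many cofinal subsets of $\alpha$; (ii) for every sequence $\langle B_i\mid i<\kappa\rangle$ of cofinal subsets of $\kappa$ and every $S\in\mathcal S$, there are stationarily many $\alpha\in S$ such that $\sup(A\cap B_i)=\alpha$ for all $A\in\mathcal A_\alpha$ and $i<\alpha$; (iii) for all distinct $A,A'$ from $\bigcup_{S\in\mathcal S}\bigcup_{\alpha\in S}\mathcal A_\alpha$, $|A\cap A'|<\mathrm{cf}(\sup(A))$. *)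

(* Defs.v *)
From mathcomp Require Export all_boot all_order.
From mathcomp Require Export boolp classical_sets functions cardinality.

Set Implicit Arguments.
Unset Strict Implicit.
Unset Printing Implicit Defensive.

Local Open Scope order_scope.
Local Open Scope card_scope.
Local Open Scope classical_set_scope.

(* An ordinal kappa is presented as a type K with a well-founded total order:
   the elements of K are the ordinals below kappa. As for von Neumann ordinals,
   an ordinal at most kappa is also identified with the set of its
   predecessors: the ordinals at most kappa are the downward closed subsets
   of K, namely [below a] for a : K, and [setT] for kappa itself. Cardinals are
   initial ordinals. *)

Section Ordinals.
Context {d : Order.disp_t} {K : orderType d}.
Implicit Types (a b c l m : K) (A B C I J X : set K).

Definition below a : set K := [set b | b < a].

Definition is_ordinal I := forall a b, b < a -> I a -> I b.

Definition is_limit a :=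
  (exists b, b < a) /\ forall b, b < a -> exists c, b < c /\ c < a.

(* The supremum of a set of ordinals, i.e. the union of its elements seen as
   von Neumann ordinals; it equals [below a] exactly when a is the least upper
   bound of A, and [setT] when A is unbounded and K has no maximum. *)
Definition osup A : set K := \bigcup_(a in A) below a.

Definition cofinal_in I A :=
  A `<=` I /\ forall b, I b -> exists2 c, A c & b <= c.

(* The least ordinal J from which there is a map with cofinal range in I; the
   minimum of a nonempty class of ordinals is its intersection (J = I always
   belongs to the class when I is an ordinal). *)
Definition cf I : set K :=
  \bigcap_(J in [set J | is_ordinal J /\
                         exists f : K -> K, cofinal_in I (f @` J)]) J.

Definition card_lt A B := A #<= B /\ ~ (B #<= A).

Definition is_cardinal l := forall a, a < l -> card_lt (below a) (below l).

Definition infinite_regular_cardinal l :=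
  [/\ is_cardinal l, infinite_set (below l) & cf (below l) = below l].

Definition closed_in A :=
  forall a, is_limit a -> osup (A `&` below a) = below a -> A a.

Definition club C := closed_in C /\ cofinal_in setT C.

Definition stationary A := forall C, club C -> A `&` C !=set0.

End Ordinals.

Definition well_ordered (d : Order.disp_t) (K : orderType d) :=
  well_founded (fun a b : K => a < b).

(* The order type of K is the least ordinal of cardinality greater than l. *)
Definition is_succ_cardinal (d : Order.disp_t) (K : orderType d) (l : K) :=
  ~ ([set: K] #<= below l) /\ forall a : K, below a #<= below l.

(* E^kappa_l, where kappa is the order type of K *)
Definition Ecf (d : Order.disp_t) (K : orderType d) (l : K) : set K :=
  [set a | cf (below a) = below l].

Definition stick (d : Order.disp_t) (K : orderType d) (l : K) :=
  exists x : K -> set K,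
    (forall b, x b #= below l) /\
    forall X, cofinal_in setT X -> exists b, x b `<=` X.

(* club_{ad^*}(SS, m, kappa), where kappa is the order type of K; only the
   values of AA on the union of SS are relevant. *)
Definition clubsuit_ad_star (d : Order.disp_t) (K : orderType d)
    (SS : set (set K)) (m : K) :=
  exists AA : K -> set (set K),
    [/\ forall a, (\bigcup_(S in SS) S) a -> is_limit a ->
          [/\ trivIset (AA a) id,
              AA a #= below m
            & forall A, AA a A -> cofinal_in (below a) A],
        forall B : K -> set K, (forall i, cofinal_in setT (B i)) ->
          forall S, SS S ->
            stationary [set a | S a /\
              forall A, AA a A -> forall i, i < a ->
                osup (A `&` B i) = below a]
      & forall A A',
          (\bigcup_(S in SS) \bigcup_(a in S) AA a) A ->
          (\bigcup_(S in SS) \bigcup_(a in S) AA a) A' ->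
          A <> A' -> card_lt (A `&` A') (cf (osup A))].

(* Main.v *)
(* Let x_b (b < l^+) witness stick and let y_b be the union of the x_z with
   z in x_b. The families A_a are built by recursion on a in E_l: every member
   of A_a meets each x_b and y_b with b < a that is not covered, up to fewer
   than l points, by fewer than l of the previously built sets, while it meets
   each previously built set in fewer than l points; a recursion of length l
   provides l many disjoint such members. The point is that every cofinal B
   contains an x_b or a y_b that is never covered in this way. Otherwise every
   x_b inside B has large intersection with some constructed set, and moving B
   up shows that these sets can be taken distinct for l^+ many b; stick, applied
   to this set of indices b, yields e such that y_e is contained in B and has
   large intersection with l of the almost disjoint sets, hence is not covered
   by fewer than l of them. Closing off under b, any a in a suitable club is a
   guess. *)
From Stdlib Require Import Relations Wellfounded.
Require Import Defs.

Set Implicit Arguments.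
Unset Strict Implicit.
Unset Printing Implicit Defensive.

Import Order.TTheory.

Local Open Scope order_scope.
Local Open Scope card_scope.
Local Open Scope classical_set_scope.

(** * Recursion with choices along a well-founded relation *)

Lemma wf_choice (I V : Type) (R : I -> I -> Prop)
    (Q : I -> (I -> V) -> V -> Prop) :
    well_founded R -> inhabited V ->
    (forall i g g' v, (forall j, R j i -> g j = g' j) -> Q i g v -> Q i g' v) ->
    (forall i g, exists v, Q i g v) ->
  exists h, forall i, Q i h (h i).
Proof.
move=> wfR [v0] Qext Qex.
(* The partial history is extended by [v0] off the predecessors of [i]; by [Qext] this default does
   not influence [Q i]. *)
pose ext i (rec : forall j, R j i -> V) j :=
  if pselect (R j i) is left r then rec j r else v0.
pose F i rec := projT1 (cid (Qex i (ext i rec))).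
have FE i f g : (forall j (r : R j i), f j r = g j r) -> F i f = F i g.
  by move=> fg; congr (F i _); apply: functional_extensionality_dep => j;
    apply: functional_extensionality_dep => r.
exists (Fix wfR (fun=> V) F) => i; rewrite Fix_eq// /F.
case: cid => v /= Qv; apply: Qext Qv => j ji.
by rewrite /ext; case: pselect.
Qed.

(** * Comparison of cardinalities by injections and surjections *)

Section Cardinality.
Context {T U : Type}.
Implicit Types (A : set T) (B : set U).

Lemma card_le_inj A B (f : T -> U) :
  (forall x, A x -> B (f x)) ->
  (forall x y, A x -> A y -> f x = f y -> x = y) -> A #<= B.
Proof.
move=> fAB finj; suff [g] : $|{injfun A >-> B}| by exact: inj_card_le.
by apply/injfunPex; exists f => // x y /set_mem Ax /set_mem Ay; exact: finj.
Qed.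

Lemma card_le_injex A B : inhabited U -> A #<= B ->
  exists f : T -> U, (forall x, A x -> B (f x)) /\
                     (forall x y, A x -> A y -> f x = f y -> x = y).
Proof.
move=> [u0] /card_leP[f].
pose g x := if pselect (A x) is left Ax then val (f (SigSub (mem_set Ax))) else u0.
exists g; split=> [x Ax|x y Ax Ay]; rewrite /g.
  by case: pselect => // {}Ax; exact: set_valP.
case: pselect => // {}Ax; case: pselect => // {}Ay.
by move=> /val_inj fxy; have /(congr1 val) := inj (in_setT _) (in_setT _) fxy.
Qed.

Lemma card_le_surjex A B : A !=set0 -> A #<= B ->
  exists f : U -> T, A = f @` B.
Proof.
by move=> /set0P A0 /pfcard_geP[/eqP|/surjfunPex//]; rewrite (negbTE A0).
Qed.

End Cardinality.

Lemma card_le_setX (T T' U U' : Type) (A : set T) (A' : set T')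
    (B : set U) (B' : set U') :
  A #<= A' -> B #<= B' -> A `*` B #<= A' `*` B'.
Proof.
move=> AA' BB'; have [->//|/set0P[[a b] [/= Aa Bb]]] := eqVneq (A `*` B) set0.
have inh X Y (C : set X) (D : set Y) c : C c -> C #<= D -> inhabited Y.
  move=> Cc CD; have [f DE] := card_le_surjex (ex_intro _ c Cc : C !=set0) CD.
  by move: Cc; rewrite DE => -[y _ _].
have [f [fA fI]] := card_le_injex (inh _ _ _ _ _ Aa AA') AA'.
have [g [gB gI]] := card_le_injex (inh _ _ _ _ _ Bb BB') BB'.
apply: (@card_le_inj _ _ _ _ (fun p => (f p.1, g p.2))).
  by move=> [x y] [/= Ax By]; split=> /=; [exact: fA|exact: gB].
move=> [x y] [x' y'] [/= Ax By] [/= Ax' By'] [/fI fxx' /gI gyy'].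
by rewrite fxx'// gyy'.
Qed.

(** Hilbert's hotel: along a sequence [f] in [A], send [x] to [f 0], each [f n] to [f n.+1], and fix
    every other point. *)
Lemma card_le_setU1 (T : Type) (A : set T) (x : T) :
  infinite_set A -> A `|` [set x] #<= A.
Proof.
move=> /infiniteP Ainf.
have [f [fA fI]] := card_le_injex (inhabits x) Ainf.
have [Ax|nAx] := pselect (A x); first by apply: subset_card_le => y [|->].
pose g y := if pselect (y = x) then f 0%N else
  if pselect (exists n, f n = y) is left e then f (projT1 (cid e)).+1 else y.
have fx n : f n <> x by move=> fnx; apply: nAx; rewrite -fnx; exact: fA.
have fI' m n : f m = f n -> m = n by exact: fI.
apply: (@card_le_inj _ _ _ _ g) => [y|y z].
  rewrite /g; case: (pselect (y = x)) => [yx _|yx [|//]]; first exact: fA.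
  by case: pselect => [e Ay|//]; exact: fA.
move=> _ _; rewrite /g.
case: (pselect (y = x)) => /= yx; case: (pselect (z = x)) => /= zx.
- by rewrite yx zx.
- by case: pselect => [e /fI'//|ne e]; case: ne; exists 0%N.
- by case: pselect => [e /fI'//|ne e]; case: ne; exists 0%N.
case: pselect => [e|ne]; case: pselect => [e'|ne'] //.
- by case: cid => m /= <-; case: cid => n /= <- /fI' [->].
- by case: cid => m /= _ fz; case: ne'; exists m.+1.
- by case: cid => m /= _ fz; case: ne; exists m.+1.
Qed.

(** * Cardinal arithmetic on a well-order *)

Section WellOrder.
Context {d : Order.disp_t} {K : orderType d}.
Context (wo_K : well_ordered K).
Implicit Types (a b c l m : K).

Lemma below_leVge (T : Type) (A : set T) l :
  below l #<= A \/ exists2 a, a < l & A #<= below a.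
Proof.
have [A0|/set0P[t0 At0]] := eqVneq A set0.
  rewrite A0; have [->|/set0P[a al]] := eqVneq (below l) set0; first by left.
  by right; exists a.
pose Q a (g : K -> T) v := (exists t, A t /\ forall b, b < a -> g b <> t) ->
  A v /\ forall b, b < a -> g b <> v.
have [|a g|h hQ] := @wf_choice _ _ _ Q wo_K (inhabits t0).
- move=> a g g' v gg' Qv [t [At g't]].
  have [|Av gv] := Qv; first by exists t; split=> // b ba; rewrite gg'//; exact: g't.
  by split=> // b ba; rewrite -gg'//; exact: gv.
- have [[t tP]|nt] := pselect (exists t, A t /\ forall b, b < a -> g b <> t).
    by exists t.
  by exists t0.
have [[a al aP]|na] :=
    pselect (exists2 a, a < l & forall t, A t -> exists2 b, b < a & h b = t).
  right; exists a => //; apply: card_le_trans (card_image_le h _).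
  by apply: subset_card_le => t /aP[b ba <-]; exists b.
have {}hQ a : a < l -> A (h a) /\ forall b, b < a -> h b <> h a.
  move=> al; apply: (hQ a); apply: contrapT => nex; apply: na; exists a => // t At.
  apply: contrapT => nb; apply: nex; exists t; split=> // b ba hb.
  by apply: nb; exists b.
left; apply: (@card_le_inj _ _ _ _ h) => [a /hQ[]//|a b al bl hab].
have [ab|ba|//] := ltgtP a b.
  by have [_ /(_ _ ab)] := hQ _ bl.
by have [_ /(_ _ ba)] := hQ _ al; rewrite hab.
Qed.

(* Comparing maxima first puts the initial segment of p inside a square. *)
Let godel (p q : K * K) := slexprod K (K * K) (fun a b => a < b)
  (slexprod K K (fun a b => a < b) (fun a b => a < b))
  (Order.max p.1 p.2, p) (Order.max q.1 q.2, q).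

Let wf_godel : well_founded godel.
Proof.
apply: (wf_inverse_image _ _ _ (fun p : K * K => (Order.max p.1 p.2, p))).
exact: (wf_slexprod _ _ _ _ wo_K (wf_slexprod _ _ _ _ wo_K wo_K)).
Qed.

Let godel_total p q : p <> q -> godel p q \/ godel q p.
Proof.
move: p q => [u v] [u' v'] ne; rewrite /godel/=.
have [lt|lt|->] := ltgtP (Order.max u v) (Order.max u' v').
- by left; exact: left_slex.
- by right; exact: left_slex.
have [lt|lt|uu'] := ltgtP u u'.
- by left; apply: right_slex; exact: left_slex.
- by right; apply: right_slex; exact: left_slex.
subst u'; have [lt|lt|vv'] := ltgtP v v'.
- by left; apply: right_slex; exact: right_slex.
- by right; apply: right_slex; exact: right_slex.
by rewrite vv' in ne.
Qed.

Let godel_max p q : godel p q -> Order.max p.1 p.2 <= Order.max q.1 q.2.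
Proof.
rewrite /godel => pq; inversion pq; subst; first exact: ltW.
by rewrite lexx.
Qed.

(** By induction, [a] may be assumed not equinumerous with any smaller ordinal. Each [godel] segment
    of a pair below [a] then has too few elements to exhaust [below a], so recursion along [godel]
    can always choose a fresh value below [a]. *)
Lemma card_below_setX a :
  infinite_set (below a) -> below a `*` below a #<= below a.
Proof.
elim: a / (wo_K a) => a _ IH ainf.
have [[b ba ab]|ncard] := pselect (exists2 b, b < a & below a #<= below b).
  have binf : infinite_set (below b) by apply: contra_not ainf; exact: card_le_finite.
  apply: card_le_trans (card_le_setX ab ab) _.
  apply: card_le_trans (IH _ ba binf) _.
  by apply: subset_card_le => c /= cb; exact: lt_trans ba.
have segment_small p : Order.max p.1 p.2 < a ->
    ~ (below a #<= [set q | godel q p]).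
  set m := Order.max _ _ => ma seg.
  have {seg} : below a #<= (below m `|` [set m]) `*` (below m `|` [set m]).
    apply: card_le_trans seg _; apply: subset_card_le => q /= /godel_max.
    rewrite ge_max -/m => /andP[q1 q2].
    by split=> /=; rewrite /below/=;
      [move: q1|move: q2]; rewrite le_eqVlt => /orP[/eqP|]; [right|left|right|left].
  have [mfin|minf] := pselect (finite_set (below m)).
    move=> /card_le_finite fin; apply: ainf; apply: fin.
    by apply: finite_setX; rewrite finite_setU; split=> //; exact: finite_set1.
  move=> /card_le_trans seg; apply: ncard; exists m => //; apply: seg.
  have mm := card_le_setU1 m minf.
  exact: card_le_trans (card_le_setX mm mm) (IH _ ma minf).
pose Q p (g : K * K -> K) v := Order.max p.1 p.2 < a ->
  v < a /\ forall q, godel q p -> g q <> v.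
have [|p g|r rP] := @wf_choice _ _ _ Q wf_godel (inhabits a).
- move=> p g g' v gg' Qv /Qv[va gv]; split=> // q qp.
  by rewrite -gg'//; exact: gv.
- have [pa|pa] := boolP (Order.max p.1 p.2 < a); last first.
    by exists a => ap; rewrite ap in pa.
  apply: contrapT => nv; apply: (segment_small _ pa).
  apply: card_le_trans (card_image_le g _); apply: subset_card_le => v va.
  apply: contrapT => nq; apply: nv; exists v => _; split=> // q qp gq.
  by apply: nq; exists q.
have max_lt p : (below a `*` below a) p -> Order.max p.1 p.2 < a.
  by move=> [p1 p2]; rewrite gt_max; apply/andP.
apply: (@card_le_inj _ _ _ _ r) => [p /max_lt pa|p q /max_lt pa /max_lt qa rpq].
  by have [] := rP _ pa.
apply: contrapT => /godel_total[pq|qp].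
  by have [_ /(_ _ pq)] := rP _ qa.
by have [_ /(_ _ qp)] := rP _ pa; rewrite rpq.
Qed.

Lemma card_bigcup_below (I T : Type) (D : set I) (F : I -> set T) l :
  infinite_set (below l) -> D #<= below l ->
  (forall i, D i -> F i #<= below l) -> \bigcup_(i in D) F i #<= below l.
Proof.
move=> linf Dl Fl.
have [->//|/set0P[t0 [i0 _ _]]] := eqVneq (\bigcup_(i in D) F i) set0.
have [f [fl fI]] := card_le_injex (inhabits l) Dl.
have /choice[g gP] : forall i, exists g : T -> K, D i ->
    (forall x, F i x -> g x < l) /\
    (forall x y, F i x -> F i y -> g x = g y -> x = y).
  move=> i; have [Di|nDi] := pselect (D i); last by exists (fun=> l).
  by have [g gP] := card_le_injex (inhabits l) (Fl _ Di); exists g.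
have /choice[ind indP] : forall t, exists i,
    (\bigcup_(i in D) F i) t -> D i /\ F i t.
  move=> t; have [[i Di Fit]|nt] := pselect ((\bigcup_(i in D) F i) t).
    by exists i.
  by exists i0.
apply: card_le_trans (card_below_setX linf).
apply: (@card_le_inj _ _ _ _ (fun t => (f (ind t), g (ind t) t))).
  move=> t /indP[Di Fit]; split=> /=; first exact: fl.
  by have [gl _] := gP _ Di; exact: gl.
move=> s t /indP[Dis Fs] /indP[Dit Ft] [/fI fE].
rewrite -fE// in Ft *; by have [_ gI] := gP _ Dis; exact: gI.
Qed.

End WellOrder.

(** * Least elements, suprema and smallness *)

Lemma wo_min (d : Order.disp_t) (K : orderType d) (P : K -> Prop) :
  well_ordered K -> (exists a, P a) ->
  exists2 a, P a & forall b, P b -> a <= b.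
Proof.
move=> wo_K [a]; elim: a / (wo_K a) => a _ IH Pa.
have [[b ba Pb]|nb] := pselect (exists2 b, b < a & P b); first exact: IH Pb.
exists a => // b Pb; rewrite leNgt; apply/negP => ba; apply: nb.
by exists b.
Qed.

Lemma osup_sub (d : Order.disp_t) (K : orderType d) (A : set K) a :
  A `<=` below a -> osup A `<=` below a.
Proof. by move=> Aa c [b /Aa ba cb]; exact: lt_trans ba. Qed.

Lemma osup_below (d : Order.disp_t) (K : orderType d) (A : set K) a :
  A `<=` below a -> (forall b, b < a -> exists2 c, A c & b < c) ->
  osup A = below a.
Proof.
move=> Aa Acof; apply/seteqP; split; first exact: osup_sub.
by move=> b /Acof[c Ac bc]; exists c.
Qed.

(* Cardinalities are measured against the cardinal [l]: [tiny] means fewer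
   than [l] elements, whereas having at most [l] elements is written
   [_ #<= below l]. *)
Definition tiny (d : Order.disp_t) (K : orderType d) (l : K) (T : Type)
  (A : set T) := ~ (below l #<= A).

(* When l is regular, this is the l-complete ideal generated by AA and the
   sets of size less than l. *)
Definition meagre (d : Order.disp_t) (K : orderType d) (l : K) (T : Type)
    (AA : set (set T)) (w : set T) :=
  exists F s, [/\ F `<=` AA, tiny l F, tiny l s & w `<=` \bigcup_(A in F) A `|` s].

(** * Small sets relative to a regular cardinal *)

Section Regular.
Context {d : Order.disp_t} {K : orderType d} (l : K).
Context (wo_K : well_ordered K) (reg_l : infinite_regular_cardinal l).

Local Notation tiny := (tiny l).

Let l_inf : infinite_set (below l). Proof. by case: reg_l. Qed.

Lemma tiny_card_le (T U : Type) (A : set T) (B : set U) :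
  A #<= B -> tiny B -> tiny A.
Proof. by move=> AB tB lA; apply: tB; exact: card_le_trans lA AB. Qed.

Lemma tiny_subset (T : Type) (A B : set T) : A `<=` B -> tiny B -> tiny A.
Proof. by move=> AB; apply: tiny_card_le; exact: subset_card_le. Qed.

Lemma tinyP (T : Type) (A : set T) :
  tiny A -> exists2 a, a < l & A #<= below a.
Proof. by move=> tA; have [//|] := below_leVge wo_K A l. Qed.

Lemma tiny_below a : a < l -> tiny (below a).
Proof. by case: reg_l => card_l _ _ /card_l[]. Qed.

Lemma tiny_finite (T : Type) (A : set T) : finite_set A -> tiny A.
Proof. by move=> fA /card_le_finite lA; exact/l_inf/lA. Qed.

Lemma finite_card_le_below (T : Type) (A : set T) :
  finite_set A -> A #<= below l.
Proof.
move=> /finite_set_countable Ac; apply: card_le_trans Ac _.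
exact/infiniteP.
Qed.

Lemma card_le_below_setU (T : Type) (A B : set T) :
  A #<= below l -> B #<= below l -> A `|` B #<= below l.
Proof.
move=> Al Bl; rewrite -bigcup2inE.
apply: card_bigcup_below => //; first exact/finite_card_le_below/finite_II.
by case=> [|[|]].
Qed.

(** An unbounded [T] would be the image of some [below c] with [c < l], forcing [cf (below a)] into
    [below c]. *)
Lemma Ecf_tiny_bounded a (T : set K) : Ecf l a -> T `<=` below a -> tiny T ->
  exists2 b, b < a & forall t, T t -> t < b.
Proof.
move=> cfa Ta tT; apply: contrapT => nb.
have Tcof b : b < a -> exists2 t, T t & b <= t.
  move=> ba; apply: contrapT => nt; apply: nb; exists b => // t Tt.
  by rewrite ltNge; apply/negP => bt; apply: nt; exists t.
suff [c cl [f TE]] : exists2 c, c <= l /\ below c != below l & exists f, T = f @` below c.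
  have : below l `<=` below c.
    rewrite -cfa; apply: bigcap_inf; split.
      by move=> u v vu /= uc; exact: lt_trans uc.
    by exists f; rewrite -TE.
  case: cl => cl /eqP ne sub; apply: ne; apply/seteqP; split=> //.
  by move=> u /= /lt_le_trans; apply.
(* An empty [T] is no image of a nonempty segment, so there [c] is the least element of [K]. *)
have [T0|/set0P Tn0] := eqVneq T set0.
  have /infinite_setN0[u ul] := l_inf.
  have [c _ cmin] := wo_min wo_K (ex_intro (fun=> True) u I).
  have c0 : below c = set0.
    by rewrite -subset0 => v /= vc; have := cmin v I; rewrite leNgt vc.
  exists c; last by exists id; rewrite T0 c0 image_set0.
  split; first exact: cmin.
  by apply/eqP => E; apply: l_inf; rewrite -E c0; exact: finite_set0.
have [c cl Tc] := tinyP tT; exists c; last exact: card_le_surjex.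
split; first exact: ltW.
by apply/eqP => E; have := tiny_below cl; rewrite E; apply; exact: card_lexx.
Qed.

Lemma Ecf_is_limit a : Ecf l a -> is_limit a.
Proof.
move=> cfa; split=> [|b ba].
  have [//||b ba _] := @Ecf_tiny_bounded a set0 cfa; last by exists b.
  exact/tiny_finite/finite_set0.
have [||c ca bc] := @Ecf_tiny_bounded a [set b] cfa.
- by move=> _ ->.
- exact/tiny_finite/finite_set1.
by exists c; split=> //; exact: bc.
Qed.

Let Ecf_l : Ecf l l. Proof. by case: reg_l. Qed.

(** Otherwise some [g] maps the union onto [below l]. Regularity bounds [g] on each [F i] by some
    [s i < l], and then all the [s i] by one [b < l]; but [b] is itself a value of [g]. *)
Lemma tiny_bigcup (I T : Type) (D : set I) (F : I -> set T) :
  tiny D -> (forall i, D i -> tiny (F i)) -> tiny (\bigcup_(i in D) F i).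
Proof.
move=> tD tF lF.
have [g lE] := card_le_surjex (infinite_setN0 l_inf) lF.
have gl t : (\bigcup_(i in D) F i) t -> g t < l.
  by move=> Ft; change (below l (g t)); rewrite lE; exists t.
have /choice[s sP] : forall i, exists b, D i ->
    b < l /\ forall t, F i t -> g t < b.
  move=> i; have [Di|nDi] := pselect (D i); last by exists l.
  have [||b bl bP] := @Ecf_tiny_bounded l (g @` F i) Ecf_l.
  - by move=> _ [t Ft <-]; apply: gl; exists i.
  - exact: tiny_card_le (card_image_le _ _) (tF _ Di).
  by exists b => _; split=> // t Ft; apply: bP; exists t.
have [||b bl bP] := @Ecf_tiny_bounded l (s @` D) Ecf_l.
- by move=> _ [i Di <-]; have [] := sP _ Di.
- exact: tiny_card_le (card_image_le _ _) tD.
have : below l b by [].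
rewrite lE => -[t [i Di Ft] gtb].
have [_ /(_ _ Ft)] := sP _ Di; rewrite gtb => bs.
have := lt_trans bs (bP (s i) _); rewrite ltxx => E.
by have : false by apply: E; exists i.
Qed.

Lemma tiny_setU (T : Type) (A B : set T) : tiny A -> tiny B -> tiny (A `|` B).
Proof.
move=> tA tB; rewrite -bigcup2inE.
by apply: tiny_bigcup => [|[|[|]]//]; exact/tiny_finite/finite_II.
Qed.

(* At step j < l the recursion picks a point of the j-th set of P that avoids
   the first j members of AA and all points picked before. *)
Lemma disjoint_refinement (T : Type) (P AA : set (set T)) :
  P !=set0 -> P #<= below l -> AA #<= below l ->
  (forall w, P w -> ~ meagre l AA w) ->
  exists E : K -> set T,
    [/\ forall i w, i < l -> P w -> E i `&` w !=set0,
        forall i j t, E i t -> E j t -> i = j,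
        forall i A, AA A -> tiny (E i `&` A)
      & forall i, E i `<=` \bigcup_(w in P) w].
Proof.
move=> [w0 Pw0] Pl AAl Ppos.
have posP w F s : P w -> F `<=` AA -> tiny F -> tiny s ->
    exists t, [/\ w t, ~ (\bigcup_(A in F) A) t & ~ s t].
  move=> Pw FA tF ts; apply: contrapT => nt; apply: (Ppos _ Pw).
  exists F, s; split=> // t wt; apply: contrapT => /not_orP[nF ns].
  by apply: nt; exists t.
have [t0 _] : exists t, [/\ w0 t, ~ (\bigcup_(A in @set0 (set T)) A) t & ~ set0 t].
  by apply: posP => //; exact/tiny_finite/finite_set0.
have [u0 u0l] := infinite_setN0 l_inf.
(* One enumeration of length [l] serves every pair of a set [w] in [P] and an index [i]; the point
   picked for the pair goes into [E i]. *)
have [||e eE] := @card_le_surjex _ _ (P `*` below l) (below l).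
- by exists (w0, u0).
- exact: card_le_trans (card_le_setX Pl (card_lexx _)) (card_below_setX wo_K l_inf).
have [c [cl cI]] := card_le_injex (inhabits l) AAl.
have eP j : j < l -> P (e j).1.
  by move=> jl; have [] : (P `*` below l) (e j) by rewrite eE; exists j.
pose Q j (g : K -> T) v := j < l ->
  [/\ (e j).1 v, forall A, AA A -> c A < j -> ~ A v & forall k, k < j -> g k <> v].
have [|j g|h hP] := @wf_choice _ _ _ Q wo_K (inhabits t0).
- move=> j g g' v gg' Qv /Qv[ev Av gv]; split=> // k kj.
  by rewrite -gg'//; exact: gv.
- have [jl|jl] := boolP (j < l); last by exists t0 => jl'; rewrite jl' in jl.
  have [|||t [wt Ft st]] :=
      @posP (e j).1 [set A | AA A /\ c A < j] (g @` below j) (eP _ jl).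
  + by move=> A [].
  + apply: tiny_card_le (tiny_below jl).
    by apply: (@card_le_inj _ _ _ _ c) => [A []//|A A' [AA1 _] [AA2 _]]; exact: cI.
  + exact: tiny_card_le (card_image_le _ _) (tiny_below jl).
  exists t => _; split=> // [A AAA cA At|k kj gk]; first by apply: Ft; exists A.
  by apply: st; exists k.
have hI j k : j < l -> k < l -> h j = h k -> j = k.
  move=> jl kl hjk; have [jk|kj|//] := ltgtP j k.
    by have [_ _ /(_ _ jk)] := hP _ kl.
  by have [_ _ /(_ _ kj)] := hP _ jl; rewrite hjk.
exists (fun i => [set t | exists j, [/\ j < l, (e j).2 = i & h j = t]]); split.
- move=> i w il Pw; have : (P `*` below l) (w, i) by [].
  rewrite eE => -[j jl ej]; exists (h j); split; first by exists j; rewrite ej.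
  by have [] := hP _ jl; rewrite ej.
- by move=> i i' t [j [jl <- <-]] [k [kl <- /(hI _ _ kl jl) ->]].
- move=> i A AAA.
  (* Steps after [c A] avoid [A], so only the points picked up to step [c A], inclusive, can lie in
     it. *)
  have : tiny (h @` below (c A) `|` [set h (c A)]).
    apply: tiny_setU; last exact/tiny_finite/finite_set1.
    exact: tiny_card_le (card_image_le _ _) (tiny_below (cl _ AAA)).
  apply: tiny_subset => _ [[j [jl _ <-]] Ahj].
  have [jc|cj|->] := ltgtP j (c A); [by left; exists j| |by right].
  by have [_ /(_ _ AAA cj)] := hP _ jl.
- move=> i _ [j [jl _ <-]]; exists (e j).1; first exact: eP.
  by have [] := hP _ jl.
Qed.

End Regular.

(** * Bounded sets and clubs in the successor cardinal *)

Section Successor.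
Context {d : Order.disp_t} {K : orderType d} (l : K).
Context (wo_K : well_ordered K) (reg_l : infinite_regular_cardinal l).
Context (K_succ : is_succ_cardinal l).

Let l_inf : infinite_set (below l). Proof. by case: reg_l. Qed.

(** If [A] were unbounded, [K] would be a union of at most [l] closed initial segments, each of size
    at most [l]. *)
Lemma card_le_bounded (A : set K) :
  A #<= below l -> exists b, forall a, A a -> a < b.
Proof.
move=> Al; apply: contrapT => nb; case: K_succ => + below_l; apply.
have : \bigcup_(a in A) (below a `|` [set a]) #<= below l.
  apply: card_bigcup_below => // a _.
  by apply: card_le_below_setU => //; exact/finite_card_le_below/finite_set1.
apply: card_le_trans; apply: subset_card_le => b _; apply: contrapT => bA.
apply: nb; exists b => a Aa; rewrite ltNge; apply/negP => ba; apply: bA.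
by exists a => //; move: ba; rewrite le_eqVlt => /orP[/eqP|]; [right|left].
Qed.

Lemma bounded_card_le (A : set K) b :
  (forall a, A a -> a < b) -> A #<= below l.
Proof.
move=> Ab; case: K_succ => _ /(_ b); apply: card_le_trans.
exact: subset_card_le.
Qed.

Lemma club_setT : club [set: K].
Proof. by split=> // ; split=> // b _; exists b. Qed.

(** For closure at a limit, two arguments below [a] lie below a common member of the set. For
    cofinality, jump repeatedly to a point of [C] above all values of [g] so far, and take the
    supremum of omega many jumps. *)
Lemma club_closure (C : set K) (g : K -> K -> K) : club C ->
  club [set a | C a /\ forall i j, i < a -> j < a -> g i j < a].
Proof.
set D := [set a | _]; move=> [Cclosed [_ Ccof]]; split.
  move=> a alim Da; split.
    apply: Cclosed => //; apply/seteqP; split; first by apply: osup_sub => b [].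
    move=> b ba; have : osup (D `&` below a) b by rewrite Da.
    by move=> [c [[Cc _] ca] bc]; exists c.
  have Dcof i : i < a -> exists e, [/\ D e, e < a & i < e].
    by move=> ia; have : below a i by []; rewrite -Da => -[e [De ea] ie]; exists e.
  move=> i j /Dcof[e [[_ ge] ea ie]] /Dcof[e' [[_ ge'] ea' je']].
  have [le|/ltW le] := leP e e'.
    by apply: lt_trans (ge' _ _ _ _) ea' => //; exact: lt_le_trans le.
  by apply: lt_trans (ge _ _ _ _) ea => //; exact: lt_le_trans le.
split=> // b0 _.
have /choice[f fP] : forall b, exists b', [/\ C b', b < b' &
    forall i j, i < b -> j < b -> g i j < b'].
  move=> b.
  have : (fun p => g p.1 p.2) @` (below b `*` below b) `|` [set b] #<= below l.
    apply: card_le_below_setU => //; last exact/finite_card_le_below/finite_set1.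
    apply: card_le_trans (card_image_le _ _) _.
    apply: card_le_trans (card_le_setX _ _) (card_below_setX wo_K l_inf);
      by case: K_succ.
  move=> /card_le_bounded[c cP]; have [b' Cb' cb'] := Ccof c I.
  exists b'; split=> //; first by apply: lt_le_trans cb'; apply: cP; right.
  move=> i j ib jb; apply: lt_le_trans cb'; apply: cP; left.
  by exists (i, j).
pose s n := iter n f b0.
have sS n : s n < s n.+1 by have [] := fP (s n).
have [a aP amin] : exists2 a, (forall n, s n < a) &
    forall b, (forall n, s n < b) -> a <= b.
  apply: wo_min => //.
  have [|b bP] := @card_le_bounded (range s); last first.
    by exists b => n; apply: bP; exists n.
  by apply: card_le_trans (card_image_le _ _) _; exact/infiniteP.
have sa b : b < a -> exists n, b < s n.
  move=> ba; apply: contrapT => nn; have := amin b; rewrite leNgt ba => E.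
  suff : false by []; apply: E => n; apply: contrapT => /negP.
  by rewrite -leNgt => bs; apply: nn; exists n.+1; exact: le_lt_trans (sS n).
have s_mono m n : (m <= n)%N -> s m <= s n.
  by move=> /subnK <-; elim: (n - m)%N => // k IH; apply: le_trans IH (ltW (sS _)).
exists a; last exact: (ltW (aP 0%N)).
split.
  apply: Cclosed.
    split=> [|b /sa[n bn]]; first by exists (s 0%N); exact: aP.
    by exists (s n); split=> //; exact: aP.
  apply: osup_below => [b []//|b /sa[n bn]].
  exists (s n.+1); last exact: lt_trans (sS n).
  by split; [have [] := fP (s n)|exact: aP].
move=> i j /sa[m im] /sa[n jn]; apply: lt_trans (aP (maxn m n).+1).
have [_ _] := fP (s (maxn m n)); apply.
  by apply: lt_le_trans im (s_mono _ _ _); exact: leq_maxl.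
by apply: lt_le_trans jn (s_mono _ _ _); exact: leq_maxr.
Qed.

End Successor.

(** * Meagre sets and the guesses provided by stick *)

Section Guessing.
Context {d : Order.disp_t} {K : orderType d} (l : K).
Context (wo_K : well_ordered K) (reg_l : infinite_regular_cardinal l).
Context (K_succ : is_succ_cardinal l).

Let l_inf : infinite_set (below l). Proof. by case: reg_l. Qed.

Lemma meagre_subset (T : Type) (AA AA' : set (set T)) (w : set T) :
  AA `<=` AA' -> meagre l AA w -> meagre l AA' w.
Proof.
by move=> sub [F [s [FA tF ts wF]]]; exists F, s; split=> // A /FA/sub.
Qed.

(** Since [a] has cofinality [l], the bounds of fewer than [l] sets and a small remainder stay below
    some [c < a], and [c] itself is left uncovered. *)
Lemma tail_not_meagre (AA : set (set K)) a b : Ecf l a -> b < a ->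
    (forall A, AA A -> exists2 c, c < a & A `<=` below c) ->
  ~ meagre l AA ([set c | b <= c] `&` below a).
Proof.
move=> cfa ba AAb [F [s [FA tF ts cover]]].
have /choice[u uP] : forall A, exists c, F A -> c < a /\ A `<=` below c.
  move=> A; have [/FA/AAb[c]|] := pselect (F A); last by exists a.
  by exists c.
have [||c ca cP] := @Ecf_tiny_bounded _ _ l wo_K reg_l a
    ((u @` F `|` s `&` below a) `|` [set b]) cfa.
- by move=> c [[[A FA1 <-]|[]//]|->//]; have [] := uP _ FA1.
- apply: tiny_setU => //; last exact/tiny_finite/finite_set1.
  apply: tiny_setU => //; first exact: tiny_card_le (card_image_le _ _) tF.
  by apply: tiny_subset ts => c [].
have [|[A FA1 Ac]|sc] := cover c.
- by split=> //; apply: ltW; apply: cP; right.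
- have [_ /(_ _ Ac)] := uP _ FA1.
  by rewrite /below/= ltNge le_eqVlt cP ?orbT//; left; left; exists A.
- by have := cP c; rewrite ltxx => E; have : false by apply: E; left; right.
Qed.

Section Stick.
Context (x : K -> set K) (card_x : forall b, x b #= below l).
Context (x_guess : forall X, cofinal_in setT X -> exists b, x b `<=` X).

Definition stick_union b := \bigcup_(z in x b) x z.

Let x_not_tiny b : ~ tiny l (x b).
Proof. by apply; have /card_eqPle[] := card_x b. Qed.

(** The contradiction is a count: the elements of a suitable [x e] yield distinct members of [AA],
    all of which must occur in any small cover of [stick_union e]. *)
Lemma stick_not_meagre (AA : set (set K)) (B : set K) :
  (forall A, AA A -> exists a, A `<=` below a) ->
  (forall A A', AA A -> AA A' -> A <> A' -> tiny l (A `&` A')) ->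
  cofinal_in setT B ->
  exists b w, [/\ w = x b \/ w = stick_union b, w `<=` B & ~ meagre l AA w].
Proof.
move=> AAb AAad [_ Bcof]; apply: contrapT => nB.
have {nB} Bmeagre b w : w = x b \/ w = stick_union b -> w `<=` B -> meagre l AA w.
  by move=> wb wB; apply: contrapT => nw; apply: nB; exists b, w.
(* If [A] were missing from [F], almost disjointness would make [A] meet each member of [F] in a
   small set, and so make its trace on [w] small. *)
have AA_cover A F s w : AA A -> ~ tiny l (A `&` w) -> F `<=` AA -> tiny l F ->
    tiny l s -> w `<=` \bigcup_(A in F) A `|` s -> F A.
  move=> AAA nt FA tF ts wF; apply: contrapT => nFA; apply: nt.
  have : tiny l (\bigcup_(A' in F) (A `&` A') `|` s).
    apply: tiny_setU => //; apply: tiny_bigcup => // A' FA'.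
    by apply: AAad => //; [exact: FA|move=> AA'; apply: nFA; rewrite AA'].
  apply: tiny_subset => t [At /wF[[A' FA' A't]|st]]; last by right.
  by left; exists A'.
(* The triple [p c] consists of the index of a guess inside [B] from [c] on, a member of [AA]
   meeting that guess in a large set, and a bound of this member. *)
have /choice[p pP] : forall c, exists p : K * set K * K,
    [/\ x p.1.1 `<=` B `&` [set t | c <= t], AA p.1.2,
        ~ tiny l (p.1.2 `&` x p.1.1) & p.1.2 `<=` below p.2].
  move=> c; have [|b bP] := @x_guess (B `&` [set t | c <= t]).
    split=> // b _; have [e Be be] := Bcof (Order.max b c) I.
    by move: be; rewrite ge_max => /andP[be ce]; exists e.
  have [|F [s [FA tF ts xF]]] := @Bmeagre b (x b) (or_introl erefl).
    by move=> t /bP[].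
  suff [A FA1 nA] : exists2 A, F A & ~ tiny l (A `&` x b).
    by have [a Aa] := AAb _ (FA _ FA1); exists (b, A, a); split=> //=; exact: FA.
  apply: contrapT => nA; apply: (@x_not_tiny b).
  have : tiny l (\bigcup_(A in F) (A `&` x b) `|` s).
    apply: tiny_setU => //; apply: tiny_bigcup => // A FA1.
    by apply: contrapT => tA; apply: nA; exists A.
  apply: tiny_subset => t xt; have [[A FA1 At]|st] := xF _ xt; last by right.
  by left; exists A.
pose beta c := (p c).1.1; pose A_ c := (p c).1.2; pose alpha c := (p c).2.
have pB c : x (beta c) `<=` B by move=> t; have [+ _ _ _] := pP c => /[apply] -[].
have pc c t : x (beta c) t -> c <= t by have [+ _ _ _] := pP c => /[apply] -[].
have pA c : AA (A_ c) by have [] := pP c.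
have pnt c : ~ tiny l (A_ c `&` x (beta c)) by have [] := pP c.
have pal c t : A_ c t -> t < alpha c by have [_ _ _ +] := pP c; apply.
have pne c : A_ c `&` x (beta c) !=set0.
  apply/set0P/eqP => E; apply: (pnt c); rewrite E.
  exact/tiny_finite/finite_set0.
(* [G] is the set of points closed under [alpha]. For [c < c'] in [G], the set [A_ c] lies below
   [c'] whereas [x (beta c')] lies at or above it; hence [A_] and [beta] are injective on [G]. *)
have [_ [_]] := @club_closure _ _ l wo_K reg_l K_succ setT (fun i _ => alpha i)
  club_setT.
set G := [set a | _] => Gcof.
have sep c c' : c < c' -> G c' -> A_ c `&` x (beta c') = set0.
  move=> cc' [_ /(_ _ _ cc' cc') ac']; rewrite -subset0 => t [/pal ta /pc c't].
  by have := lt_trans (le_lt_trans c't ta) ac'; rewrite ltxx.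
have AI c c' : G c -> G c' -> A_ c = A_ c' -> c = c'.
  move=> Gc Gc' E; have [cc'|c'c|//] := ltgtP c c'.
    by have := pne c'; rewrite -E sep// => -[].
  by have := pne c; rewrite E sep// => -[].
have betaI c c' : G c -> G c' -> beta c = beta c' -> c = c'.
  move=> Gc Gc' E; have [cc'|c'c|//] := ltgtP c c'.
    by have := pne c; rewrite E sep// => -[].
  by have := pne c'; rewrite -E sep// => -[].
have [|e xe] := @x_guess (beta @` G).
  split=> // b _; apply: contrapT => nb.
  have : G #<= below l.
    apply: (@card_le_trans _ _ _ (beta @` G)).
      by apply: (@card_le_inj _ _ _ _ beta) => // c Gc; exists c.
    apply: (@bounded_card_le _ _ _ K_succ _ b) => c Gc; rewrite ltNge.
    by apply/negP => bc; apply: nb; exists c.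
  move=> /(card_le_bounded wo_K reg_l K_succ)[a aG].
  by have [c /aG ca ac] := Gcof a I; have := lt_le_trans ca ac; rewrite ltxx.
have [|F [s [FA tF ts UF]]] := @Bmeagre e (stick_union e) (or_intror erefl).
  by move=> t [z /xe[c Gc <-]]; exact: pB.
have /choice[c cP] : forall z, exists c, x e z -> G c /\ beta c = z.
  move=> z; have [/xe[c Gc cz]|] := pselect (x e z); last by exists l.
  by exists c.
(* Each [z] in [x e] is [beta (c z)], and [A_ (c z)] has large trace on [x z], a part of
   [stick_union e]; so [AA_cover] puts it in [F]. *)
apply: (@x_not_tiny e); apply: tiny_card_le (tF).
apply: (@card_le_inj _ _ _ _ (A_ \o c)) => [z xz|z z' xz xz' /= E].
  have [Gc cz] := cP _ xz; apply: (@AA_cover _ F s _ (pA _) _ FA tF ts UF).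
  apply: contra_not (pnt (c z)); apply: tiny_subset => t [At xt]; split=> //.
  by exists z => //; rewrite -cz.
have [[Gz <-] [Gz' <-]] := (cP _ xz, cP _ xz').
by rewrite (AI _ _ Gz Gz' E).
Qed.

(** * Recursive construction of the almost disjoint families *)

(** The final segments are included so that a set meeting them all below [a] is unbounded in [a]. *)
Definition targets a : set (set K) :=
  [set w | exists2 b, b < a &
    [\/ w = x b, w = stick_union b | w = [set c | b <= c]]].

(** Here [prev] stands for all sets built before stage [a]. Targets may reach beyond [a], so only
    their traces below [a] are tested. *)
Record ad_step (a : K) (prev V : set (set K)) : Prop := AdStep {
  ad_step_triv : trivIset V id;
  ad_step_card : V #= below l;
  ad_step_sub : forall A, V A -> A `<=` below a;
  ad_step_tiny : forall A A', V A -> prev A' -> tiny l (A `&` A');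
  ad_step_meet : forall w A, targets a w -> ~ meagre l prev (w `&` below a) ->
    V A -> (A `&` (w `&` below a)) !=set0 }.

Lemma ad_step_exists a (prev : set (set K)) : Ecf l a -> prev #<= below l ->
    (forall A, prev A -> exists2 c, c < a & A `<=` below c) ->
  exists V, ad_step a prev V.
Proof.
move=> cfa prevl prevb.
(* There are at most [l] such traces, because [below a] has at most [l] elements; a final segment
   ensures that there is one. *)
pose P := [set w | exists2 v, targets a v /\ w = v `&` below a & ~ meagre l prev w].
have [[b0 b0a] _] := Ecf_is_limit wo_K reg_l cfa.
have [||//|w []//|E [Emeet EI Etiny Esub]] :=
    @disjoint_refinement _ _ l wo_K reg_l _ P prev.
- exists ([set c | b0 <= c] `&` below a); exists [set c | b0 <= c].
    by split=> //; exists b0 => //; constructor 3.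
  exact: tail_not_meagre.
- have : \bigcup_(b in below a)
      ([set x b `&` below a; stick_union b `&` below a; [set c | b <= c] `&` below a])
      #<= below l.
    apply: card_bigcup_below => //; first by case: K_succ.
    by move=> b _; apply: finite_card_le_below => //; exact: finite_set3.
  apply: card_le_trans; apply: subset_card_le => _ [v [[b ba vb] ->] _].
  by exists b => //; case: vb => ->; [left; left|left; right|right].
(* Being nonempty and pairwise disjoint, the [E i] are distinct, so the family has exactly [l]
   members. *)
have En0 i : i < l -> exists t, E i t.
  move=> il.
  have [|t [Et _]] := Emeet i ([set c | b0 <= c] `&` below a) il; last by exists t.
  exists [set c | b0 <= c]; first by split=> //; exists b0 => //; constructor 3.
  exact: tail_not_meagre.
exists (E @` below l); split.
- by move=> _ _ [i _ <-] [j _ <-] [t [/= Ei Ej]]; rewrite (EI _ _ _ Ei Ej).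
- apply: inj_card_eq => i j /set_mem/En0[t Et] _ Eij; apply: (EI _ _ _ Et).
  by rewrite -Eij.
- by move=> _ [i _ <-] t /Esub[_ [v [_ ->] _] []].
- by move=> _ A' [i _ <-]; exact: Etiny.
- by move=> w _ tw nw [i il <-]; apply: Emeet => //; exists w.
Qed.

Lemma ad_family_exists : exists AA : K -> set (set K),
  (forall a A, AA a A -> Ecf l a /\ A `<=` below a) /\
  forall a, Ecf l a -> ad_step a (\bigcup_(b in below a) AA b) (AA a).
Proof.
(* [good] supplies the hypotheses of [ad_step_exists] on earlier stages. An arbitrary history may
   violate it, so [Q] assumes it there; an induction afterwards shows that it always holds. *)
pose good a V := V #<= below l /\ forall A, V A -> Ecf l a /\ A `<=` below a.
pose Q a (g : K -> set (set K)) V := (forall b, b < a -> good b (g b)) ->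
  good a V /\ (Ecf l a -> ad_step a (\bigcup_(b in below a) g b) V).
have [|a g|AA AAP] := @wf_choice _ _ _ Q wo_K (inhabits set0).
- move=> a g g' V gg' QV good_g'.
  have [b ba|gV sV] := QV; first by rewrite gg'//; exact: good_g'.
  split=> // /sV; congr (ad_step a _ V).
  by apply: eq_bigcupr => b ba; exact: gg'.
- have [good_g|ng] := pselect (forall b, b < a -> good b (g b)); last by exists set0.
  have [cfa|ncf] := pselect (Ecf l a); last first.
    by exists set0; split=> //; split.
  have [||V VP] := @ad_step_exists a (\bigcup_(b in below a) g b) cfa.
  + apply: card_bigcup_below => //; first by case: K_succ.
    by move=> b /good_g[].
  + by move=> A [b ba gA]; exists b => //; have [_ /(_ _ gA)[]] := good_g _ ba.
  exists V => _; split=> //; split; last by move=> A /(ad_step_sub VP).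
  by have /card_eqPle[] := ad_step_card VP.
have AAgood a : good a (AA a).
  by elim: a / (wo_K a) => a _ IH; have [] := AAP a IH.
exists AA; split=> [a|a cfa]; first by have [] := AAgood a.
by have [|_] := AAP a; [move=> b _; exact: AAgood|apply].
Qed.

End Stick.
End Guessing.

(** * Verification of the three clauses of the guessing principle *)

Theorem theorem4p3 (d : Order.disp_t) (K : orderType d) (lambda : K)
  (wo_K : well_ordered K)
  (reg_lambda : infinite_regular_cardinal lambda)
  (K_succ : is_succ_cardinal lambda)
  (stick_K : stick lambda)
  (SS : set (set K))
  (part_SS : partition SS id (Ecf lambda))
  (stat_SS : forall S : set K, SS S -> stationary S) :
  clubsuit_ad_star SS lambda.
Proof.
have [x [card_x x_guess]] := stick_K.
have [AA [AA_Ecf AAstep]] := ad_family_exists wo_K reg_lambda K_succ x.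
have AAsub a A : AA a A -> A `<=` below a by move=> /AA_Ecf[].
have [SSE _ _] := part_SS.
have SS_Ecf S a : SS S -> S a -> Ecf lambda a by move=> SSS Sa; rewrite -SSE; exists S.
have AAcof a A b : Ecf lambda a -> AA a A -> b < a -> exists2 c, A c & b < c /\ c < a.
  move=> cfa AaA ba; have [_ /(_ _ ba)[e [be ea]]] := Ecf_is_limit wo_K reg_lambda cfa.
  have [||c [Ac [ec ca]]] := ad_step_meet (AAstep _ cfa) (w := [set c | e <= c]) _ _ AaA.
  - by exists e => //; constructor 3.
  - apply: tail_not_meagre => // A' [c ca AcA']; exists c => //; exact: AAsub AcA'.
  by exists c => //; split=> //; exact: lt_le_trans ec.
have AAosup a A : Ecf lambda a -> AA a A -> osup A = below a.
  move=> cfa AaA; apply: osup_below; first exact: AAsub AaA.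
  by move=> b ba; have [c Ac [bc _]] := AAcof _ _ _ cfa AaA ba; exists c.
have AAad a a' A A' : Ecf lambda a -> Ecf lambda a' -> AA a A -> AA a' A' ->
    A <> A' -> tiny lambda (A `&` A').
  move=> cfa cfa' AaA AaA' ne; have [aa'|a'a|E] := ltgtP a a'.
  - by rewrite setIC; apply: (ad_step_tiny (AAstep _ cfa')) => //; exists a.
  - by apply: (ad_step_tiny (AAstep _ cfa)) => //; exists a'.
  subst a'; have [->|/set0P AA'] := eqVneq (A `&` A') set0.
    by apply: tiny_finite => //; exact: finite_set0.
  by case: ne; exact: (ad_step_triv (AAstep _ cfa)).
exists AA; split.
- move=> a [S SSS Sa] _; have cfa := SS_Ecf _ _ SSS Sa.
  have step := AAstep _ cfa; split.
  + exact: ad_step_triv step.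
  + exact: ad_step_card step.
  + move=> A AaA; split; first exact: AAsub AaA.
    by move=> b ba; have [c Ac [bc _]] := AAcof _ _ _ cfa AaA ba; exists c => //; exact: ltW.
- move=> B Bcof S SSS C Cclub.
  pose AAll := \bigcup_(a in Ecf lambda) AA a.
  (* For each [(i, c)], [q] records an index [b], a never covered target [w] inside [B i] and above
     [c], and a strict bound [e] of both [b] and [w]. *)
  have /choice[q qP] : forall p : K * K, exists q : K * set K * K,
      [/\ q.1.2 = x q.1.1 \/ q.1.2 = stick_union x q.1.1,
          q.1.2 `<=` B p.1 `&` [set t | p.2 < t], ~ meagre lambda AAll q.1.2,
          q.1.1 < q.2 & q.1.2 `<=` below q.2].
    move=> [i c] /=.
    have [|||b [w [wb wB nw]]] := @stick_not_meagre _ _ lambda wo_K reg_lambda K_succ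
        x card_x x_guess AAll (B i `&` [set t | c < t]).
    + by move=> A [a _ AaA]; exists a; exact: AAsub AaA.
    + by move=> A A' [a cfa AaA] [a' cfa' AaA']; exact: AAad AaA AaA'.
    + split=> // b _.
      have [|e eP] := @card_le_bounded _ _ lambda wo_K reg_lambda K_succ [set b; c].
        by apply: finite_card_le_below => //; exact: finite_set2.
      have [_ /(_ e I)[f Bf ef]] := Bcof i.
      exists f; last by apply/ltW/(lt_le_trans _ ef); apply: eP; left.
      by split=> //=; apply: (lt_le_trans _ ef); apply: eP; right.
    have [|e eP] := @card_le_bounded _ _ lambda wo_K reg_lambda K_succ (w `|` [set b]).
      apply: card_le_below_setU => //; last first.
        by apply: finite_card_le_below => //; exact: finite_set1.
      have xl z : x z #<= below lambda by have /card_eqPle[] := card_x z.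
      case: wb => -> //; apply: card_bigcup_below => //.
      by case: reg_lambda.
    by exists (b, w, e); split=> //=; [apply: eP; right|move=> t wt; apply: eP; left].
  (* At a point [a] closed under these bounds, all targets recorded for [i, c < a] have index below
     [a] and lie within [below a], so the members of [AA a] had to meet them. *)
  have := club_closure wo_K reg_lambda K_succ (fun i c => (q (i, c)).2) Cclub.
  move=> /(stat_SS _ SSS)[a [Sa [Ca qa]]]; exists a; split=> //; split=> // A AaA i ia.
  have cfa := SS_Ecf _ _ SSS Sa.
  apply: osup_below => [t [At _]|c ca]; first exact: AAsub At.
  have [+ + + + +] := qP (i, c); have := qa _ _ ia ca.
  case: (q (i, c)) => -[b w] e /= ea wb wB nw be we.
  have wa : w `&` below a = w.
    by apply/setIidPl => t /we te; exact: lt_trans ea.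
  have [||t [At]] := ad_step_meet (AAstep _ cfa) (w := w) _ _ AaA.
  + by exists b; [exact: lt_trans ea|case: wb => ->; [constructor 1|constructor 2]].
  (* Not being covered by the whole family is stronger than not being covered by the sets built
     before [a]. *)
  + rewrite wa; apply: contra_not nw; apply: meagre_subset => A' [a' a'a AA'].
    by exists a' => //; have [] := AA_Ecf _ _ AA'.
  by rewrite wa => /wB[Bt ct]; exists t.
- move=> A A' [S SSS [a Sa AaA]] [S' SSS' [a' Sa' AaA']] ne.
  have [cfa cfa'] := (SS_Ecf _ _ SSS Sa, SS_Ecf _ _ SSS' Sa').
  (* As [A] has supremum [a], of cofinality [lambda], the third clause asks for an intersection of
     size less than [lambda]. *)
  rewrite (AAosup _ _ cfa AaA) cfa; split; last exact: AAad AaA AaA' ne.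
  case: K_succ => _ /(_ a); apply: card_le_trans; apply: subset_card_le.
  by move=> t [At _]; exact: AAsub At.
Qed.
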